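(* Let $p\ge 1$ and $n>p+2$ be integers, let $\mathbb{F}$ be a field of characteristic zero, and let $\mathcal{A}$ be an $n$-dimensional associative $\mathbb{F}$-algebra which is filiform of degree $p$. Then there exist $\alpha\in\{0,1\}$ and scalars $\beta_{i,j}\in\mathbb{F}$ ($1\le i,j\le p$) such that $\mathcal{A}$ is isomorphic to the algebra with basis $\{e_1,\dots,e_{n-p},f_1,\dots,f_p\}$ and multiplication \[ \left\{\begin{array}{ll} e_ie_j=e_{i+j}, & i,j\ge 1,\ 2\le i+j\le n-p,\\ e_1f_1=\alpha e_{n-p}, & \\ f_if_j=\beta_{i,j}e_{n-p}, & 1\le i,j\le p, \end{array}\right. \] where all other products of basis elements vanish.
   Context: Associative algebras are not assumed to be unital. For an algebra $\mathcal{A}$ put $\mathcal{A}^1=\mathcal{A}$ and $\mathcal{A}^{i+1}=\sum_{k=1}^{i}\mathcal{A}^k\mathcal{A}^{i+1-k}$ for $i\ge 1$ (linear spans of products). An $n$-dimensional associative algebra $\mathcal{A}$ is called filiform of degree $p$ if $\dim(\mathcal{A}^i)=n-p+1-i$ for $2\le i\le n-p+1$. *)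

(* Defs.v *)
From HB Require Import structures.
From mathcomp Require Import all_boot all_order all_algebra.

Set Implicit Arguments.
Unset Strict Implicit.
Unset Printing Implicit Defensive.
Import GRing.Theory.
Local Open Scope ring_scope.

(* MathComp's algebra structures are all unital, so a possibly non-unital      *)
(* finite-dimensional associative algebra is given here by a vectType A and an *)
(* associative product mul : {bilinear A -> A -> A}.                           *)

Section Powers.
Variables (F : fieldType) (A : vectType F) (mul : A -> A -> A).

(* The span of all products u v with u in U and v in V, built on bases as      *)
(* falgebra's prodv is; see memv_alg_prodv and alg_prodvP.                     *)
Definition alg_prodv (U V : {vspace A}) : {vspace A} :=
  <<allpairs mul (vbasis U) (vbasis V)>>%VS.

(* The list [:: A^1; ...; A^i].                                                *)
Fixpoint alg_powers (i : nat) : seq {vspace A} :=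
  if i is i'.+1 then
    let s := alg_powers i' in
    rcons s (if i' is 0 then fullv
             else (\sum_(1 <= k < i'.+1)
                     alg_prodv (nth 0 s k.-1) (nth 0 s (i' - k)))%VS)
  else [::].

(* A^i for i >= 1; the value at i = 0 is meaningless.                          *)
Definition alg_pow (i : nat) : {vspace A} := nth 0%VS (alg_powers i) i.-1.

Definition filiform (p : nat) : Prop :=
  let n := \dim {:A} in
  forall i : nat, (2 <= i <= n - p + 1)%N ->
    \dim (alg_pow i) = (n - p + 1 - i)%N.

Lemma size_alg_powers i : size (alg_powers i) = i.
Proof. by elim: i => // i IHi /=; rewrite size_rcons IHi. Qed.

Lemma nth_alg_powers i k : (k < i)%N -> nth 0%VS (alg_powers i) k = alg_pow k.+1.
Proof.
elim: i => // i IHi; rewrite ltnS leq_eqVlt => /orP[/eqP-> //|ltki].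
by rewrite /= nth_rcons size_alg_powers ltki IHi.
Qed.

Lemma alg_pow1 : alg_pow 1 = fullv. Proof. by []. Qed.

Lemma alg_powS i : (0 < i)%N ->
  alg_pow i.+1 =
  (\sum_(1 <= k < i.+1) alg_prodv (alg_pow k) (alg_pow (i.+1 - k)))%VS.
Proof.
case: i => // i _; rewrite [LHS]/alg_pow.
have -> : alg_powers i.+2 = rcons (alg_powers i.+1)
    (\sum_(1 <= k < i.+2) alg_prodv (nth 0 (alg_powers i.+1) k.-1)
                             (nth 0 (alg_powers i.+1) (i.+1 - k)))%VS by [].
rewrite nth_rcons size_alg_powers ltnn eqxx.
apply: eq_big_nat => -[|k] // /andP[_ ltki].
rewrite !nth_alg_powers //= ?subSS ?ltnS ?leq_subr //.
by rewrite subSn.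
Qed.

End Powers.

Section ProdvTheory.
Variables (F : fieldType) (A : vectType F) (mul : {bilinear A -> A -> A}).

Lemma memv_alg_prodv (U V : {vspace A}) u v :
  u \in U -> v \in V -> mul u v \in alg_prodv mul U V.
Proof.
move=> /coord_vbasis-> /coord_vbasis->; rewrite linear_sumlz.
apply: memv_suml => i _; rewrite linear_sumr; apply: memv_suml => j _.
rewrite linearZl_LR linearZr_LR !memvZ // memv_span //.
by apply: allpairs_f; apply: mem_nth; rewrite size_tuple.
Qed.

Lemma alg_prodvP (U V W : {vspace A}) :
  reflect (forall u v, u \in U -> v \in V -> mul u v \in W)
          (alg_prodv mul U V <= W)%VS.
Proof.
apply: (iffP idP) => [sUVW u v Uu Vv | sUVW].
  by rewrite (subvP sUVW) // memv_alg_prodv.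
apply/span_subvP => _ /allpairsP[[u v] /= [Uu Vv ->]].
by rewrite sUVW // vbasis_mem.
Qed.

End ProdvTheory.

Definition alg_isomorphic (F : fieldType) (A B : vectType F)
    (mulA : A -> A -> A) (mulB : B -> B -> B) : Prop :=
  exists f : {linear A -> B},
    bijective f /\ {morph f : x y / mulA x y >-> mulB x y}.

(* The algebra with basis e_1, ..., e_m, f_1, ..., f_p, where m = n - p, is     *)
(* carried by 'rV[F]_(m + p): for 0-based i : 'I_m and j : 'I_p the vector      *)
(* e_(i+1) is delta_mx 0 (lshift p i) and f_(j+1) is delta_mx 0 (rshift m j).   *)
Section Model.
Variables (F : fieldType) (m p : nat) (alpha : F) (beta : 'M[F]_p).

(* e_k, with the 1-based index k; it is 0 unless 1 <= k <= m.                   *)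
Definition basis_e (k : nat) : 'rV[F]_(m + p) :=
  \sum_(i < m | i.+1 == k) delta_mx 0 (lshift p i).

Definition basis_prod (s t : 'I_m + 'I_p) : 'rV[F]_(m + p) :=
  match s, t with
  | inl i, inl j => if (i.+1 + j.+1 <= m)%N then basis_e (i.+1 + j.+1) else 0
  | inl i, inr j =>
      if (i.+1 == 1%N) && (j.+1 == 1%N) then alpha *: basis_e m else 0
  | inr _, inl _ => 0
  | inr i, inr j => beta i j *: basis_e m
  end.

Definition model_mul (x y : 'rV[F]_(m + p)) : 'rV[F]_(m + p) :=
  \sum_s \sum_t (x 0 s * y 0 t) *: basis_prod (split s) (split t).

Lemma basis_eE (i : 'I_m) : basis_e i.+1 = delta_mx 0 (lshift p i).
Proof. exact: big_pred1. Qed.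

Lemma model_mul_delta s t :
  model_mul (delta_mx 0 s) (delta_mx 0 t) = basis_prod (split s) (split t).
Proof.
rewrite /model_mul (bigD1 s) //= [X in _ + X]big1 ?addr0 => [|s' /negPf s's].
  rewrite (bigD1 t) //= [X in _ + X]big1 ?addr0 => [|t' /negPf t't].
    by rewrite !mxE !eqxx mulr1 scale1r.
  by rewrite !mxE t't andbF mulr0 scale0r.
by rewrite big1 // => t' _; rewrite !mxE s's andbF mul0r scale0r.
Qed.

Lemma model_mul_is_bilinear : bilinear_for *:%R *:%R model_mul.
Proof.
split=> z a x y /=; rewrite /model_mul scaler_sumr -big_split /=;
  apply: eq_bigr => s _; rewrite scaler_sumr -big_split /=;
  apply: eq_bigr => t _; rewrite !mxE scalerA -scalerDl.
  by rewrite mulrDl mulrA.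
by rewrite mulrDr mulrCA.
Qed.

HB.instance Definition _ :=
  bilinear_isBilinear.Build F _ _ _ _ _ model_mul model_mul_is_bilinear.

End Model.

(* Main.v *)
(** Since [A^2 / A^3] is a line, there are [a], [b] with [ab] outside [A^3], and
    then [b^2] is outside [A^3]: otherwise, writing [ca = l ab] modulo [A^3]
    for an arbitrary [c], we get [c(ab) = (ca)b = l a(bb) = 0] modulo [A^4], so
    that [A^3 = A^4].  With [x = b], the relation [AA <= <x^2> + A^3] propagates
    to [A^i <= <x^i> + A^(i+1)], so, putting [m = n - p], the powers
    [x^2, ..., x^m] form a basis of [A^2] and [x^(m+1) = 0].  Right
    multiplication by [x] has image [A^2], hence a kernel [L] of dimension
    [p + 1], which meets [A^2] in the line of [x^m].  The [f_j] are taken in a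
    complement of that line in [L]: every product [a f_j] lies in [A^2] and is
    killed by [x] on the right, so it is a multiple of [x^m].  Finally the basis
    of the complement is adapted to the linear form [f |-> x f]. *)
Require Import Defs.
From HB Require Import structures.
From mathcomp Require Import all_boot all_order all_algebra.
Import GRing.Theory.
Local Open Scope ring_scope.

Set Implicit Arguments.
Unset Strict Implicit.
Unset Printing Implicit Defensive.

(** * Linear algebra: bases adapted to a linear form, coordinates *)

Section LinearAlgebra.
Variables (F : fieldType) (A B : vectType F).

Lemma dim1_vline (U : {vspace A}) u :
  \dim U = 1 -> u \in U -> u != 0 -> U = <[u]>%VS.
Proof.
move=> dU Uu u0; apply/esym/eqP; rewrite eqEdim -memvE Uu dU dim_vline.
by rewrite u0.
Qed.

(** If [g] vanishes on [U], any basis works with [a = 0]. Otherwise some [v] in [U] can be scaled so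
    that [g v = w], and a basis of the kernel of [g] in [U], of codimension 1, completes it with
    [a = 1]. *)
Lemma adapted_basis (U : {vspace A}) (g : 'Hom(A, B)) (w : B) :
    (g @: U <= <[w]>)%VS ->
  exists (X : seq A) (a : F), [/\ basis_of U X, a = 0 \/ a = 1
    & forall i, (i < size X)%N -> g X`_i = if i == 0 then a *: w else 0].
Proof.
move=> gU; have gUP u : u \in U -> exists c, g u = c *: w.
  by move=> Uu; apply/vlineP; apply: subvP gU _ _; apply: memv_img.
pose K := (U :&: lker g)%VS.
have [sUK | /subvPn[u Uu]] := boolP (U <= lker g)%VS.
  exists (vbasis U), 0; split=> [||i ltiX]; [exact: vbasisP | by left |].
  rewrite scale0r if_same; apply/eqP; rewrite -memv_ker.
  by apply: (subvP sUK); apply: vbasis_mem; apply: mem_nth.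
rewrite memv_ker => gu0; have [c guE] := gUP u Uu.
have c0 : c != 0 by apply: contraNneq gu0 => c0; rewrite guE c0 scale0r.
pose v := c^-1 *: u; have Uv : v \in U by rewrite memvZ.
have gv : g v = w by rewrite linearZ /= guE scalerA mulVf ?scale1r.
have w0 : w != 0 by apply: contraNneq gu0 => w0; rewrite guE w0 scaler0.
have sKU : (K <= U)%VS by apply: capvSl.
have K0 i : (i < size (vbasis K))%N -> g (vbasis K)`_i = 0.
  move=> lti; apply/eqP; rewrite -memv_ker.
  by apply: (subvP (capvSr U _)); apply: vbasis_mem; apply: mem_nth.
exists (v :: vbasis K), 1; split; [| by right |]; last first.
  by case=> [_|i /K0 //] /=; rewrite scale1r.
apply/andP; split.
  rewrite span_cons (span_basis (vbasisP K)) eqEsubv subv_add -memvE Uv sKU /=.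
  apply/subvP => h Uh; have [d ghE] := gUP h Uh.
  rewrite -(subrK (d *: v) h) addrC.
  apply: memv_add; first by rewrite memvZ ?memv_line.
  rewrite memv_cap rpredB ?memvZ //= memv_ker linearB linearZ /= gv ghE.
  by rewrite subrr.
rewrite free_cons (basis_free (vbasisP K)) (span_basis (vbasisP K)) andbT.
by rewrite memv_cap memv_ker gv (negPf w0) andbF.
Qed.

Definition coord_row n (X : n.-tuple A) (a : A) : 'rV[F]_n :=
  \row_s coord X s a.

Lemma coord_row_is_linear n (X : n.-tuple A) : linear (coord_row X).
Proof. by move=> c a b; apply/rowP => s; rewrite !mxE linearP. Qed.

HB.instance Definition _ n (X : n.-tuple A) :=
  GRing.isLinear.Build F A 'rV[F]_n _ (coord_row X) (coord_row_is_linear X).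

Definition row_comb n (X : seq A) (v : 'rV[F]_n) : A := \sum_s v 0 s *: X`_s.

Lemma row_comb_is_linear n (X : seq A) : linear (@row_comb n X).
Proof.
move=> c u v; rewrite /row_comb scaler_sumr -big_split; apply: eq_bigr => s _.
by rewrite !mxE scalerDl scalerA.
Qed.

HB.instance Definition _ n (X : seq A) :=
  GRing.isLinear.Build F 'rV[F]_n A _ (@row_comb n X)
    (@row_comb_is_linear n X).

Lemma row_comb_delta n (X : seq A) (s : 'I_n) :
  row_comb X (delta_mx 0 s) = X`_s.
Proof.
rewrite /row_comb (bigD1 s) //= big1 => [|t /negPf ts].
  by rewrite mxE !eqxx scale1r addr0.
by rewrite mxE ts andbF scale0r.
Qed.

Lemma coord_rowK n (X : n.-tuple A) :
  basis_of fullv X -> cancel (coord_row X) (row_comb X).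
Proof.
move=> bX a; rewrite [RHS](coord_basis bX) ?memvf //.
by apply: eq_bigr => s _; rewrite mxE.
Qed.

Lemma row_combK n (X : n.-tuple A) :
  basis_of fullv X -> cancel (@row_comb n X) (coord_row X).
Proof.
by move=> bX v; apply/rowP => s; rewrite mxE coord_sum_free ?(basis_free bX).
Qed.

Lemma vline_addv_eq (U V : {vspace A}) v : (U <= V)%VS ->
  \dim V = (\dim U).+1 -> v \in V -> v \notin U -> V = (<[v]> + U)%VS.
Proof.
move=> sUV dV Vv Uv; apply/esym/eqP.
rewrite eqEdim subv_add -memvE Vv sUV dV /=.
rewrite ltn_neqAle dimvS ?addvSr // andbT.
apply: contraNneq Uv => dE; have /eqP-> : U == (<[v]> + U)%VS.
  by rewrite eqEdim addvSr dE leqnn.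
by rewrite (subvP (addvSl _ _)) ?memv_line.
Qed.

Lemma memv_vline_addP (U : {vspace A}) v w :
  w \in (<[v]> + U)%VS -> exists c, exists2 u, u \in U & w = c *: v + u.
Proof. by case/memv_addP=> _ /vlineP[c ->] [u Uu ->]; exists c, u. Qed.

End LinearAlgebra.

(** * Isomorphism criterion and powers of an associative algebra *)

Section Algebra.
Variables (F : fieldType) (A : vectType F) (mul : {bilinear A -> A -> A}).

(** The isomorphism is the coordinate map of [X]. Multiplicativity is compared in [A], after
    applying the inverse [row_comb], where bilinearity reduces it to products of basis vectors. *)
Lemma alg_isomorphic_model m p (alpha : F) (beta : 'M[F]_p)
    (X : (m + p).-tuple A) :
    basis_of fullv X ->
    (forall s t : 'I_(m + p), mul X`_s X`_t =
       row_comb X (basis_prod alpha beta (split s) (split t))) ->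
  alg_isomorphic mul (@model_mul F m p alpha beta).
Proof.
move=> bX mulX; exists (coord_row X); split.
  by exists (row_comb X); [apply: coord_rowK | apply: row_combK].
move=> a b; apply: (can_inj (row_combK bX)) => /=; rewrite coord_rowK //.
rewrite -{1}(coord_rowK bX a) -{1}(coord_rowK bX b) linear_sumlz linear_sum.
apply: eq_bigr => s _; rewrite linear_sumr linear_sum; apply: eq_bigr => t _.
by rewrite linearZl_LR linearZr_LR scalerA mulX [RHS]linearZ.
Qed.

Hypothesis mulA : associative mul.
Local Notation P := (alg_pow mul).

Lemma alg_pow_mul i j a b : (0 < i)%N -> (0 < j)%N ->
  a \in P i -> b \in P j -> mul a b \in P (i + j).
Proof.
case: i => // i _; case: j => // j _ Pa Pb; rewrite addSn alg_powS ?addnS //.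
rewrite big_add1 big_mkord /=.
have lti : (i < (i + j).+1)%N by rewrite ltnS leq_addr.
rewrite (bigD1 (Ordinal lti)) //=; apply: (subvP (addvSl _ _)).
by apply: memv_alg_prodv; rewrite // subSS subSn ?leq_addr // addKn.
Qed.

(** Associativity reduces every splitting in the sum to the one with a single factor on the left: by
    strong induction a left factor from [P k.+2] is a sum of products [c d] with [d] in [P k.+1],
    and [(c d) b = c (d b)]. *)
Lemma alg_powSl i : (0 < i)%N -> P i.+1 = alg_prodv mul fullv (P i).
Proof.
move=> i0; apply/eqP; rewrite eqEsubv; apply/andP; split; last first.
  by apply/alg_prodvP => a b _ Pb; rewrite -add1n alg_pow_mul ?memvf.
elim/ltn_ind: i i0 => i IHi i0; rewrite alg_powS // big_nat_cond.
apply: (big_ind (fun U => (U <= alg_prodv mul fullv (P i))%VS))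
  => [|U V UP VP|k /andP[/andP[k0 ltki] _]].
- exact: sub0v.
- by rewrite subv_add UP.
case: k k0 ltki => // -[_ _|k _ ltki]; first by rewrite subn1.
apply: (@subv_trans _ _
  (alg_prodv mul (alg_prodv mul fullv (P k.+1)) (P (i.+1 - k.+2)))).
  apply/alg_prodvP => a b Pa Pb; apply: memv_alg_prodv => //.
  by apply: subvP Pa; apply: IHi.
apply/alg_prodvP => a b Pa Pb.
pose R := linfun (applyr mul b).
(* An element of the product space is only a sum of products, so the inclusion goes through the
   preimage under right multiplication by [b], which need only be tested on products. *)
have /subvP sR :
    (alg_prodv mul fullv (P k.+1) <= R @^-1: alg_prodv mul fullv (P i))%VS.
  apply/alg_prodvP => c d _ Pd; rewrite -memv_preim lfunE /= /applyr -mulA.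
  apply: memv_alg_prodv; first exact: memvf.
  have -> : i = (k.+1 + (i.+1 - k.+2))%N by rewrite subSS subnKC // ltnW.
  by apply: alg_pow_mul; rewrite // subn_gt0.
by have := sR a Pa; rewrite -memv_preim lfunE.
Qed.

Lemma alg_powS_sub i : (0 < i)%N -> (P i.+1 <= P i)%VS.
Proof.
elim: i => // -[_ _|i IHi _]; first exact: subvf.
rewrite (alg_powSl (i := i.+2)) // (alg_powSl (i := i.+1)) //.
apply/alg_prodvP => a b Aa Pb.
by apply: memv_alg_prodv => //; apply: (subvP (IHi isT)); rewrite alg_powSl.
Qed.

Lemma alg_pow_sub i j : (0 < i <= j)%N -> (P j <= P i)%VS.
Proof.
case/andP=> i0 /subnKC <-; elim: (j - i)%N => [|k IHk]; first by rewrite addn0.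
by rewrite addnS (subv_trans _ IHk) // alg_powS_sub // addn_gt0 i0.
Qed.

(** * Generating the powers modulo higher ones by a single element *)

Lemma exists_square_notin_pow3 :
    \dim (P 2) = (\dim (P 3)).+1 -> ~~ (P 3 <= P 4)%VS ->
  exists x, mul x x \notin P 3.
Proof.
move=> dP2 nP34; have sP32 : (P 3 <= P 2)%VS by apply: alg_powS_sub.
(* [P 2] is spanned by these products, so they cannot all lie in the smaller space [P 3]. *)
have : ~~ all (mem (P 3)) (allpairs mul (vbasis {:A}) (vbasis {:A})).
  apply/negP => /allP /span_subvP sP23.
  have /dimvS : (P 2 <= P 3)%VS by rewrite [X in (X <= _)%VS]alg_powSl.
  by rewrite dP2 ltnn.
case/allPn=> _ /allpairsP[[a b] /= [_ _ ->]] Pab; exists b.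
apply: contra nP34 => Pbb.
have defP2 : P 2 = (<[mul a b]> + P 3)%VS.
  by apply: vline_addv_eq => //; apply: (alg_pow_mul (i := 1) (j := 1)) => //;
    apply: memvf.
have A1 c : c \in P 1 by apply: memvf.
rewrite [X in (X <= _)%VS]alg_powSl //; apply/alg_prodvP => c u _.
rewrite defP2 => /memv_vline_addP[l [w Pw ->]].
rewrite linearDr linearZr_LR mulA; apply: memvD; last first.
  exact: (alg_pow_mul (i := 1) (j := 3)).
(* With [c a = k (a b) + w'], the product [(c a) b] becomes [k a (b b) + w' b], and both terms lie
   in [P 4]. *)
have := alg_pow_mul (i := 1) (j := 1) isT isT (A1 c) (A1 a).
rewrite defP2 => /memv_vline_addP[k [w' Pw' ->]].
rewrite memvZ // linearDl linearZl_LR -mulA; apply: memvD.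
  by rewrite memvZ //; apply: (alg_pow_mul (i := 1) (j := 3)).
exact: (alg_pow_mul (i := 3) (j := 1)).
Qed.

(* [powS x k] is [x^(k+1)]: there is no unit. *)
Definition powS (x : A) (k : nat) : A := iter k (mul x) x.
Arguments powS : simpl never.

Lemma powSD x i j : mul (powS x i) (powS x j) = powS x (i + j).+1.
Proof.
by elim: i => // i IHi; rewrite addSn [powS x i.+1]/powS /= -mulA IHi.
Qed.

Lemma powSSr x i : mul (powS x i) x = powS x i.+1.
Proof. by rewrite -[x in mul _ x]/(powS x 0) powSD addn0. Qed.

Lemma powS_in x i : powS x i \in P i.+1.
Proof.
elim: i => [|i IHi]; first exact: memvf.
exact: (alg_pow_mul (i := 1) (j := i.+1) isT isT (memvf _)).
Qed.

(** Inductive step: [c x^(i+2) = (c x) x^(i+1)], and [c x] is a multiple of [x^2] modulo [P 3],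
    which leaves a multiple of [x^(i+3)] modulo [P i.+4]. *)
Lemma alg_pow_gen x : (P 2 <= <[mul x x]> + P 3)%VS ->
  forall i, (P i.+2 <= <[powS x i.+1]> + P i.+3)%VS.
Proof.
move=> /subvP sP2; elim=> [|i IHi]; first exact/subvP.
rewrite [X in (X <= _)%VS]alg_powSl //; apply/alg_prodvP => c u _.
move=> /(subvP IHi) /memv_vline_addP[l [w Pw ->]].
rewrite linearDr linearZr_LR [mul c (powS _ _)]mulA; apply: memvD; last first.
  apply: (subvP (addvSr _ _)).
  exact: (alg_pow_mul (i := 1) (j := i.+3) isT isT (memvf _)).
have := alg_pow_mul (i := 1) (j := 1) isT isT (memvf c) (memvf x).
move=> /sP2 /memv_vline_addP[k [w' Pw' ->]]; rewrite memvZ //.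
rewrite linearDl linearZl_LR -[mul x x]/(powS x 1) powSD.
rewrite memv_add ?memvZ ?memv_line //.
exact: (alg_pow_mul (i := 3) (j := i.+1) isT isT Pw' (powS_in x i)).
Qed.

(** * Structure of a filiform algebra, with [n - p = k + 2] *)

Section Filiform.
Variables (k p : nat).
Hypothesis dimA : \dim {:A} = (k.+2 + p)%N.
Hypothesis dimP : forall i, (1 < i <= k.+3)%N -> \dim (P i) = (k.+3 - i)%N.
Variable x : A.
Hypothesis xxP3 : mul x x \notin P 3.

(** Because of the shift in [powS] this is [x^(k+2)], which spans the last nonzero power
    [P k.+2]. *)
Local Notation z := (powS x k.+1).
Let R := linfun (applyr mul x).

Let RE a : R a = mul a x. Proof. by rewrite lfunE. Qed.

Let P0 : P k.+3 = 0%VS.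
Proof. by apply/eqP; rewrite -dimv_eq0 dimP ?ltnSn ?subnn. Qed.

Let powS0 i : (k.+2 <= i)%N -> powS x i = 0.
Proof.
move=> leki; apply/eqP; rewrite -memv0 -P0.
exact: (subvP (alg_pow_sub (j := i.+1) _) _ (powS_in x i)).
Qed.

Let genP i : (P i.+2 <= <[powS x i.+1]> + P i.+3)%VS.
Proof.
apply: alg_pow_gen; rewrite (@vline_addv_eq _ _ (P 3) (P 2) (mul x x)) //.
- exact: alg_powS_sub.
- by rewrite !dimP // !subSS !subn0.
- exact: (powS_in x 1).
Qed.

Let x_notin : x \notin P 2.
Proof.
apply: contra xxP3 => Px.
exact: (alg_pow_mul (i := 1) (j := 2) isT isT (memvf x)).
Qed.

(** Otherwise [genP] would give [P i.+1 = P i.+2], against the dimensions; [i = 0] is [x_notin]. *)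
Let powS_notin i : (i < k.+2)%N -> powS x i \notin P i.+2.
Proof.
case: i => // i ; rewrite !ltnS => leik; apply/negP => Pi.
have : (P i.+2 <= P i.+3)%VS.
  by rewrite (subv_trans (genP i)) // subv_add -memvE Pi subvv.
move/dimvS; rewrite !dimP ?ltnS ?leqW //.
by rewrite !subSS subSn // ltnn.
Qed.

(** Built downwards from [P k.+3 = 0], one power of [x] being adjoined at each step; [j] counts the
    powers. *)
Let powS_basis t j : (t.+1 + j = k.+2)%N ->
  basis_of (P t.+2) [seq powS x i | i <- iota t.+1 j].
Proof.
elim: j t => [|j IHj] t.
  by rewrite addn0 => -[->] /=; rewrite P0 /basis_of span_nil eqxx nil_free.
rewrite addnS -addSn => def_k; have bj := IHj _ def_k.
have ltt : (t.+1 < k.+2)%N by rewrite -def_k leq_addr.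
apply/andP; split; last first.
  by rewrite /= free_cons (basis_free bj) (span_basis bj) powS_notin.
rewrite /= span_cons (span_basis bj) eqEsubv genP subv_add -memvE powS_in /=.
by rewrite alg_powS_sub.
Qed.

Let R_im t : (t < k.+2)%N -> (R @: P t.+1)%VS = P t.+2.
Proof.
move=> ltt; apply/eqP; rewrite eqEsubv; apply/andP; split.
  apply/subvP => _ /memv_imgP[a Pa ->]; rewrite RE -[t.+2]addn1.
  exact: (alg_pow_mul (i := t.+1) (j := 1) _ _ _ (memvf _)).
have /powS_basis/span_basis<- : (t.+1 + (k.+1 - t) = k.+2)%N.
  by rewrite addSn subnKC.
apply/span_subvP => _ /mapP[[|i] + ->]; rewrite mem_iota // => /andP[lti _].
rewrite -powSSr -RE memv_img //.
exact: (subvP (alg_pow_sub (j := i.+1) _) _ (powS_in x i)).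
Qed.

Let dim_kerR : \dim (lker R) = p.+1.
Proof.
have := limg_ker_dim R fullv; rewrite (R_im (t := 0)) // capfv dimA dimP //.
by rewrite !subSS subn0 addSnnS [RHS]addnC => /addIn.
Qed.

Let dim_kerR_P2 : \dim (lker R :&: P 2) = 1.
Proof.
have := limg_ker_dim R (P 2); rewrite (R_im (t := 1)) // !dimP //.
by rewrite !subSS !subn0 -[k.+1]add1n capvC => /addIn.
Qed.

Let zL : z \in lker R.
Proof. by rewrite memv_ker RE powSSr powS0. Qed.

Let kerR_P2 : (lker R :&: P 2 = <[z]>)%VS.
Proof.
apply: dim1_vline => //.
  rewrite memv_cap zL /=.
  exact: (subvP (alg_pow_sub (j := k.+2) _) _ (powS_in x k.+1)).
by apply: contraNneq (powS_notin (ltnSn k.+1)) => ->; rewrite mem0v.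
Qed.

(** This is the complement of the line of [z] in the kernel of [R], not the whole kernel; the [f_j]
    will be a basis of it. *)
Local Notation L := (lker R :\: <[z]>)%VS.

Let dimL : \dim L = p.
Proof.
have := dimv_cap_compl (lker R) <[z]>; rewrite dim_kerR.
have -> : (lker R :&: <[z]>)%VS = <[z]>%VS by apply/capv_idPr; rewrite -memvE.
have -> : \dim <[z]> = 1 by rewrite -kerR_P2 dim_kerR_P2.
by rewrite add1n => -[].
Qed.

Let mulLx f : f \in L -> mul f x = 0.
Proof. by move/(subvP (diffvSl _ _)); rewrite memv_ker RE => /eqP. Qed.

Let mul_pow2 a b : mul a b \in P 2.
Proof. exact: (alg_pow_mul (i := 1) (j := 1) isT isT (memvf a) (memvf b)). Qed.

Let mulL a f : f \in L -> mul a f \in <[z]>%VS.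
Proof.
move=> Lf; rewrite -kerR_P2 memv_cap memv_ker RE -mulA mulLx //.
by rewrite linear0r eqxx mul_pow2.
Qed.

Let mul_powS_z i : mul (powS x i) z = 0.
Proof. by rewrite powSD powS0 // !ltnS leq_addl. Qed.

Let E := [seq powS x i | i <- iota 0 k.+2].

Let E_free : free E.
Proof.
have bE : basis_of (P 2) [seq powS x i | i <- iota 1 k.+1] by exact: powS_basis.
by rewrite /E /= free_cons (basis_free bE) (span_basis bE) x_notin.
Qed.

Let E_span : <<E>>%VS = (<[x]> + P 2)%VS.
Proof.
have bE : basis_of (P 2) [seq powS x i | i <- iota 1 k.+1] by exact: powS_basis.
by rewrite /E /= span_cons (span_basis bE).
Qed.

(** The count is right, so the spans need only be independent. If [v = l x + w] is in [L] with [w]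
    in [P 2], then [v x = 0] puts [l x x] in [P 3], so [l = 0]; then [v] is a multiple of [z], and
    [L] meets that line trivially. *)
Let basis_EX X : basis_of L X -> basis_of fullv (E ++ X).
Proof.
move=> bX; rewrite basisEfree subvf cat_free E_free (basis_free bX) /=.
rewrite size_cat size_map size_iota -(size_basis (X := in_tuple X) bX) dimL dimA.
rewrite leqnn andbT.
apply/directv_addP; rewrite E_span (span_basis bX).
apply/eqP; rewrite -subv0; apply/subvP => v; rewrite memv_cap.
case/andP=> /memv_vline_addP[l [w Pw def_v]] Lv.
have l0 : l = 0.
  apply: contraNeq xxP3 => l0.
  have Pwx : mul w x \in P 3.
    exact: (alg_pow_mul (i := 2) (j := 1) isT isT Pw (memvf _)).
  have := mulLx Lv; rewrite def_v linearDl linearZl_LR => /eqP.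
  rewrite addr_eq0 => /eqP defP.
  by rewrite -[mul x x](scalerK l0) memvZ // defP memvN.
have Zv : v \in <[z]>%VS.
  rewrite -kerR_P2 memv_cap (subvP (diffvSl _ _) _ Lv).
  by rewrite def_v l0 scale0r add0r.
by rewrite -(capv_diff (lker R) <[z]>) memv_cap Lv Zv.
Qed.

(** * The multiplication table *)

Lemma filiform_model : exists (alpha : F) (beta : 'M[F]_p),
  (alpha = 0 \/ alpha = 1) /\
  alg_isomorphic mul (@model_mul F k.+2 p alpha beta).
Proof.
have gL : (linfun (mul x) @: L <= <[z]>)%VS.
  by apply/subvP => _ /memv_imgP[f Lf ->]; rewrite lfunE mulL.
have [X [alpha [bX alpha01 gX]]] := adapted_basis gL.
have sizeX : size X = p by rewrite -(size_basis (X := in_tuple X) bX) dimL.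
have LX (i : 'I_p) : X`_i \in L.
  by rewrite (basis_mem bX) // mem_nth ?sizeX.
have mulXX (ij : 'I_p * 'I_p) : exists c, mul X`_ij.1 X`_ij.2 = c *: z.
  by apply/vlineP; apply: mulL.
have [b bE] := fin_all_exists mulXX.
exists alpha, (\matrix_(i, j) b (i, j)); split=> //.
have sizeEX : size (E ++ X) == (k.+2 + p)%N.
  by rewrite size_cat size_map size_iota sizeX.
pose Y := Tuple sizeEX; have bY : basis_of fullv Y by apply: basis_EX.
have EXl (i : 'I_k.+2) : Y`_(lshift p i) = powS x i.
  rewrite nth_cat size_map size_iota /= ltn_ord (nth_map 0%N) ?size_iota //.
  by rewrite nth_iota.
have EXr (j : 'I_p) : Y`_(rshift k.+2 j) = X`_j.
  by rewrite nth_cat size_map size_iota /= ltnNge leq_addr addKn.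
(* This holds for every [i]: beyond the range both sides are 0. *)
have comb_e i : row_comb Y (basis_e F k.+2 p i.+1) = powS x i.
  have [lti | lei] := ltnP i k.+2.
    by rewrite (basis_eE F p (Ordinal lti)) row_comb_delta EXl.
  rewrite powS0 // /basis_e big_pred0 ?linear0 // => j.
  by apply/negbTE; rewrite eqSS neq_ltn (leq_trans (ltn_ord j)).
clearbody Y; apply: (alg_isomorphic_model bY) => s t.
rewrite -{1}(splitK s) -{1}(splitK t).
case: (split s) => i; case: (split t) => j /=.
- rewrite !EXl powSD (_ : i.+1 + j.+1 = (i + j).+2)%N; last first.
    by rewrite addSn addnS.
  case: ifPn => [_|]; first by rewrite comb_e.
  by rewrite -leqNgt ltnS => lem; rewrite powS0 // linear0.
- rewrite EXl EXr; case: i => -[|i] lti /=; last first.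
    (* Here [x^(i+2) f = x^(i+1) (x f)] is a multiple of [x^(i+1) z = 0]. *)
    have /vlineP[c xXE] := mulL x (LX j).
    rewrite -[powS x i.+1]powSSr -mulA xXE linearZr_LR mul_powS_z scaler0.
    by rewrite linear0.
  have := gX j; rewrite sizeX lfunE => -> //.
  by rewrite eqSS; case: ifP => _; rewrite ?linear0 // linearZ /= comb_e.
- rewrite EXl EXr linear0; case: j => -[|j] ltj /=; first exact: mulLx (LX i).
  by rewrite /powS /= mulA (mulLx (LX i)) linear0l.
- by rewrite !EXr [LHS](bE (i, j)) linearZ /= comb_e mxE.
Qed.

End Filiform.
End Algebra.

Theorem theorem3p3 (p n : nat) (F : fieldType) (A : vectType F)
    (mul : {bilinear A -> A -> A}) :
  (1 <= p)%N -> (p + 2 < n)%N ->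
  [pchar F] =i pred0 ->
  associative mul ->
  \dim {:A} = n ->
  filiform mul p ->
  exists (alpha : F) (beta : 'M[F]_p),
    (alpha = 0 \/ alpha = 1) /\
    alg_isomorphic mul (@model_mul F (n - p) p alpha beta).
Proof.
move=> _ ltn _ mulA dimA; rewrite /filiform /= dimA => dimP.
(* As [n - p] is at least 3, the dimension formula reaches [P 4], which is therefore strictly
   smaller than [P 3]. The section above is used with [k.+1] for its [k]. *)
have [k def_n] : exists k, n = (k.+3 + p)%N.
  by exists (n - p.+3)%N; rewrite !addSnnS subnK // -[p.+3]addn3 addnS.
move: dimA dimP; rewrite {n ltn}def_n addnK addn1 => dimA dimP.
have [||x xx] := @exists_square_notin_pow3 F A mul mulA.
- by rewrite !dimP // !subSS !subn0.
- by apply/negP => /dimvS; rewrite !dimP // !subSS !subn0 ltnn.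
exact: (filiform_model mulA dimA dimP xx).
Qed.
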